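(* Let $G=(V,E)$ be a graph of order $n$, let $m=\sum_{v\in V}\binom{\deg(v)}{2}$, and let $\overline{cr}(G)$ be its rectilinear crossing number. Then \[\psi_g(G)\le \left\lfloor \frac{1+\sqrt{1+8(m+\overline{cr}(G))}}{2}\right\rfloor .\]
   Context: A geometric graph of $G$ is a drawing of $G$ in the plane with vertices at distinct points in general position (no three collinear) and edges as straight-line segments. Two edges intersect if they share an endpoint or cross. An edge coloring with $k$ colors is a surjective map from the edge set onto $\{1,\dots,k\}$; it is complete if for every pair of distinct colors there is an edge of the first color and an edge of the second color that intersect. For a geometric graph $\mathsf{G}$, $\psi_1(\mathsf{G})$ is the largest $k$ admitting a complete edge coloring with $k$ colors, and $\psi_g(G)=\min\{\psi_1(\mathsf{G}) : \mathsf{G}$ a geometric graph of $G\}$. The rectilinear crossing number $\overline{cr}(G)$ is the minimum, over all geometric graphs of $G$, of the number of edge crossings. *)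

(* Defs.v *)
From HB Require Import structures.
From mathcomp Require Import all_boot all_order all_algebra.
From mathcomp Require Import boolp reals.
From mathcomp Require Import ring.

Set Implicit Arguments.
Unset Strict Implicit.
Unset Printing Implicit Defensive.

Import Order.TTheory GRing.Theory Num.Theory.
Local Open Scope ring_scope.

Record sgraph (V : finType) := SGraph {
  adj : rel V;
  adj_sym : symmetric adj;
  adj_irr : irreflexive adj }.

Section Graph.
Variables (V : finType) (G : sgraph V).

Definition deg (v : V) : nat := #|[set w | adj G v w]|.

Definition edges : {set {set V}} :=
  [set A | [exists u, exists v, adj G u v && (A == [set u; v])]].

(* A colouring is a function on this subtype, so that the edgeless graph does
   have a (unique) colouring with 0 colours. *)
Definition edge := {A : {set V} | A \in edges}.

End Graph.

Section Plane.
Variable R : realType.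
Implicit Types a b x o d : 'rV[R]_2.

Definition on_line o d x : Prop := exists t : R, x = o + t *: d.

Definition collinear a b x : Prop :=
  exists o d, [/\ d != 0, on_line o d a, on_line o d b & on_line o d x].

Definition open_segment a b x : Prop :=
  exists t : R, 0 < t < 1 /\ x = (1 - t) *: a + t *: b.

End Plane.

(* The edges of the drawing are the straight segments between the images of
   adjacent vertices, so the positions of the vertices determine it. *)
Record geom_graph (R : realType) (V : finType) (G : sgraph V) := GeomGraph {
  pos : V -> 'rV[R]_2;
  pos_inj : injective pos;
  pos_general : forall u v w : V, u != v -> u != w -> v != w ->
    ~ collinear (pos u) (pos v) (pos w) }.

Section Drawing.
Variables (R : realType) (V : finType) (G : sgraph V).
Variable D : geom_graph R G.

Definition edge_interior (A : edge G) (x : 'rV[R]_2) : Prop :=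
  exists u v : V, val A = [set u; v] /\ open_segment (pos D u) (pos D v) x.

Definition cross (A B : edge G) : Prop :=
  A != B /\ exists x, edge_interior A x /\ edge_interior B x.

Definition share_endpoint (A B : edge G) : Prop :=
  exists v : V, v \in val A /\ v \in val B.

Definition intersect (A B : edge G) : Prop :=
  share_endpoint A B \/ cross A B.

(* Crossings are unordered pairs of crossing edges: three edges through a
   common interior point contribute three crossings. *)
Definition crossings : nat :=
  #|[set P : {set edge G} | `[< exists A B, P = [set A; B] /\ cross A B >]]|.

Definition surjective_coloring k (c : edge G -> 'I_k) : Prop :=
  forall i, exists A, c A = i.

Definition complete_coloring k (c : edge G -> 'I_k) : Prop :=
  forall i j, i != j -> exists A B, [/\ c A = i, c B = j & intersect A B].

Definition completely_colorable (k : nat) : Prop :=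
  exists c : edge G -> 'I_k, surjective_coloring c /\ complete_coloring c.

Lemma completely_colorable_ex : exists k, `[< completely_colorable k >].
Proof.
have [/eqP E0|] := boolP (#|{: edge G}| == 0)%N.
  have no (A : edge G) : False by exact: fintype0 A E0.
  exists 0%N; apply/asboolP; exists (fun A => False_rect _ (no A)).
  by split=> -[].
rewrite -lt0n => /card_gt0P [A0 _].
exists 1%N; apply/asboolP; exists (fun=> ord0); split=> [i|i j].
  by exists A0; rewrite [i]ord1.
by rewrite [i]ord1 [j]ord1 eqxx.
Qed.

Lemma completely_colorable_le k :
  `[< completely_colorable k >] -> (k <= #|{: edge G}|)%N.
Proof.
move=> /asboolP [c [csurj _]].
pose f i := sval (cid (csurj i)).
have fK : cancel f c by move=> i; rewrite /f; case: cid.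
by rewrite -[k]card_ord; apply: leq_card (can_inj fK).
Qed.

Definition psi1 : nat := ex_maxn completely_colorable_ex completely_colorable_le.

End Drawing.

Section Minimum.
Variables (T : Type) (f : T -> nat) (inhT : inhabited T).

Lemma value_ex : exists k, `[< exists x, f x = k >].
Proof. by case: inhT => x; exists (f x); apply/asboolP; exists x. Qed.

Definition min_value : nat := ex_minn value_ex.

End Minimum.

(* Placing the vertices on a parabola gives a geometric graph of G. *)
Lemma geom_graph_inhabited (R : realType) (V : finType) (G : sgraph V) :
  inhabited (geom_graph R G).
Proof.
pose h (v : V) : R := (enum_rank v)%:R.
have h_inj : injective h.
  by move=> u v /eqP; rewrite eqr_nat => /eqP /ord_inj /enum_rank_inj.
pose p v : 'rV[R]_2 := \row_(i < 2) h v ^+ i.+1.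
have p_inj : injective p.
  by move=> u v /rowP /(_ 0); rewrite !mxE !expr1 => /h_inj.
suff p_gen u v w : u != v -> u != w -> v != w ->
    ~ collinear (p u) (p v) (p w) by exact: (inhabits (GeomGraph G p_inj p_gen)).
move=> uv uw vw [o [d [_ [t1 e1] [t2 e2] [t3 e3]]]].
have ne x y : x != y -> h x - h y != 0 by rewrite subr_eq0 (inj_eq h_inj).
have co x t : p x = o + t *: d ->
    h x = o 0 0 + t * d 0 0 /\ h x ^+ 2 = o 0 1 + t * d 0 1.
  by move=> /rowP ex; move: (ex 0) (ex 1); rewrite !mxE expr1.
have [a1 b1] := co _ _ e1; have [a2 b2] := co _ _ e2; have [a3 b3] := co _ _ e3.
have slope x y t s : x != y ->
    h x = o 0 0 + t * d 0 0 -> h x ^+ 2 = o 0 1 + t * d 0 1 ->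
    h y = o 0 0 + s * d 0 0 -> h y ^+ 2 = o 0 1 + s * d 0 1 ->
    d 0 1 = (h x + h y) * d 0 0.
  move=> xy ax bx ay b_y; apply: (mulfI (ne _ _ xy)).
  have -> : (h x - h y) * ((h x + h y) * d 0 0)
          = (h x ^+ 2 - h y ^+ 2) * d 0 0 by ring.
  by rewrite bx b_y ax ay; ring.
have s12 := slope _ _ _ _ uv a1 b1 a2 b2.
have s13 := slope _ _ _ _ uw a1 b1 a3 b3.
have d0 : d 0 0 = 0.
  apply: (mulfI (ne _ _ vw)); rewrite mulr0.
  have -> : (h v - h w) * d 0 0 = (h u + h v) * d 0 0 - (h u + h w) * d 0 0.
    by ring.
  by rewrite -s12 -s13 subrr.
by move: (ne _ _ uv); rewrite a1 a2 d0 !mulr0 subrr eqxx.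
Qed.

Definition psi_g (R : realType) (V : finType) (G : sgraph V) : nat :=
  min_value (@psi1 R V G) (geom_graph_inhabited R G).

Definition rectilinear_cr (R : realType) (V : finType) (G : sgraph V) : nat :=
  min_value (@crossings R V G) (geom_graph_inhabited R G).

(* Main.v *)
(** In a complete colouring with [k] colours, any two distinct colours [i], [j]
    are the colours of two intersecting edges, and the unordered pair of these
    edges determines the pair of colours.  So ['C(k, 2)] is at most the number of
    pairs of distinct intersecting edges: at most [m] of them share an endpoint,
    and the others are crossings. *)
Require Import Defs.
From HB Require Import structures.
From mathcomp Require Import all_boot all_order all_algebra.
From mathcomp Require Import boolp reals.
From mathcomp Require Import zify lra.

Set Implicit Arguments.
Unset Strict Implicit.
Unset Printing Implicit Defensive.

Import Order.TTheory GRing.Theory Num.Theory.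
Local Open Scope ring_scope.

(** Every edge at [v] is the image of some neighbour [w] under [w] ↦ [[set v; w]]. *)
Lemma card_incident_edges (V : finType) (G : sgraph V) (v : V) :
  (#|[set A : edge G | v \in val A]| <= deg G v)%N.
Proof.
rewrite -(card_imset _ val_inj).
apply: leq_trans (leq_imset_card (fun w => [set v; w]) _).
apply/subset_leq_card/subsetP => _ /imsetP[A + ->]; rewrite inE.
have := valP A; rewrite inE => /existsP[x /existsP[y /andP[xy /eqP ->]]].
rewrite !inE => /orP[] /eqP ->; apply/imsetP.
  by exists y; rewrite ?inE.
by exists x; rewrite ?inE 1?adj_sym 1?setUC.
Qed.

Lemma card_adjacent_edge_pairs (V : finType) (G : sgraph V) :
  (#|\bigcup_(v : V) [set P : {set edge G} |
       P \subset [set A : edge G | v \in val A] & #|P| == 2]|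
     <= \sum_(v : V) 'C(deg G v, 2))%N.
Proof.
elim/big_rec2: _ => [|v k S _ leS]; first by rewrite cards0.
rewrite (leq_trans (leq_card_setU _ _)) // leq_add //.
by rewrite cards_draws leq_bin2l // card_incident_edges.
Qed.

Lemma bin2_psi1_le (R : realType) (V : finType) (G : sgraph V)
    (D : geom_graph R G) :
  ('C(psi1 D, 2) <= \sum_(v : V) 'C(deg G v, 2) + crossings D)%N.
Proof.
rewrite /psi1; case: ex_maxnP => k /asboolP[c [_ c_complete]] _.
apply: leq_trans (leq_add (card_adjacent_edge_pairs G) (leqnn _)).
apply: leq_trans (leq_card_setU _ _).
(* It remains to see that [P] ↦ [c @: P] maps the pairs of intersecting edges onto a family
   containing all 2-sets of colours. *)
apply: leq_trans (leq_imset_card (fun P : {set edge G} => c @: P) _).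
rewrite -{1}[k]card_ord -card_draws; apply/subset_leq_card/subsetP => Q.
rewrite inE => /cards2P[i [j [ij ->]]].
have [A [B [cA cB AB]]] := c_complete i j ij.
have neqAB : A != B by apply: contraNneq ij => eqAB; rewrite -cA -cB eqAB.
apply/imsetP; exists [set A; B]; last by rewrite imsetU1 imset_set1 cA cB.
rewrite inE; apply/orP; case: AB => [[v [vA vB]]|AB]; [left|right].
  apply/bigcupP; exists v => //; rewrite inE cards2 neqAB andbT.
  by apply/subsetP => C /set2P[] ->; rewrite inE.
by rewrite inE; apply/asboolP; exists A, B.
Qed.

(** Completing the square in $k^2 - k \le 2N$ gives $(2k-1)^2 \le 1 + 8N$. *)
Lemma le_floor_of_bin2_le (R : realType) (k N : nat) : ('C(k, 2) <= N)%N ->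
  k%:Z <= Num.floor ((1 + Num.sqrt (1 + 8 * N%:R)) / 2 : R).
Proof.
move=> leN; rewrite floor_ge_int -pmulrn ler_pdivlMr //.
have {leN} : ((k * k)%N <= 2 * N + k)%N.
  by have := mul_bin_diag k 1; rewrite bin1; nia.
rewrite -(ler_nat R) natrD !natrM => leN.
suff : k%:R * 2 - 1 <= Num.sqrt (1 + 8 * N%:R) :> R by lra.
(* Passing through $|2k-1|$ also covers $k = 0$, where $2k-1$ is negative. *)
apply: le_trans (ler_norm _) _; rewrite -sqrtr_sqr ler_wsqrtr //; nra.
Qed.

Theorem theorem6 (R : realType) (V : finType) (G : sgraph V)
    (n m : nat) (hn : #|V| = n)
    (hm : m = (\sum_(v : V) 'C(deg G v, 2))%N) :
  (psi_g R G)%:Z <=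
    Num.floor ((1 + Num.sqrt (1 + 8 * (m + rectilinear_cr R G)%:R)) / 2 : R).
Proof.
apply: le_floor_of_bin2_le; rewrite hm /rectilinear_cr /min_value.
(* [D] attains the rectilinear crossing number; it need not minimise [psi1], but [psi1 D] is at
   least [psi_g]. *)
case: ex_minnP => _ /asboolP[D <-] _.
apply: leq_trans (bin2_psi1_le D); apply: leq_bin2l.
rewrite /psi_g /min_value; case: ex_minnP => k _; apply.
by apply/asboolP; exists D.
Qed.
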